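(* Let $B=(P,m,N,\varphi)$ be a smooth formal background with versal solution $\Pi\in\mathbf{QM}_B(R)$, quantum superconnection $\nabla=\hbar d_{dR}+A^1+A^2+\cdots$ and associated maps $\Phi^n$ ($n\ge0$), and let $\int$ be a chain level path integral pairing for $B$. Then the primary correlation form $\int\Phi$, $\Phi=\Phi^0+\Phi^1+\Phi^2+\cdots$, satisfies $$\nabla\int\Phi=0,$$ that is, for every $n\ge0$ and every $i$, $$\hbar d_{dR}\int\Phi^n_i=\sum_{j=0}^n\sum_l(A^{n+1-j})_i{}^l\int\Phi^j_l .$$
   Context: Let $k$ be a field of characteristic $0$ and $\Lambda=k[[\hbar]]$ (degree $0$, zero differential). All objects are $\mathbb Z$-graded and $[\,,\,]$ is the graded commutator. **Parameter rings.** $\mathfrak C_\Lambda$: objects are graded commutative unital local $\Lambda$-algebras $A$ with residue field $k$, nilpotent finite dimensional maximal ideal $\mathfrak m_A$, $\Lambda\to A$ local, and a $\Lambda$-linear degree one derivation $d$, $d^2=0$, with $[1]\ne0$ in $H(A,d)$; morphisms are local differential $\Lambda$-algebra maps inducing the identity on residue fields. $\widehat{\mathfrak C}_\Lambda$: the complete noetherian local differential graded $\Lambda$-algebras $A$ with all $A/\mathfrak m_A^j\in\mathfrak C_\Lambda$. $\otimes$ is the completed tensor product over $\Lambda$. Functors on $\mathfrak C_\Lambda$ are extended to $\widehat{\mathfrak C}_\Lambda$ by inverse limits. **Homotopy.** $I'=k[u,v]$, $\deg u=0,\deg v=1$, $d(p(u)+q(u)v)=p'(u)v$. For a functor $\mathbf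 G$, $\xi_0\sim\xi_1$ in $\mathbf G(A)$ if they are the evaluations at $(u,v)=(0,0),(1,0)$ of some $\xi(u,v)\in\mathbf G(A')$ with $A'\subset A\otimes_kI'$ an Artin subalgebra with maximal ideal in $\mathfrak m_A\otimes_kI'$; homotopy of morphisms $A\to A_1$ is defined likewise, $\mathrm{hot}(A,A_1)$ being the set of homotopy classes. $\mathbf F$ is homotopy represented by $(R,\Pi)$ if it induces a functor on the homotopy category isomorphic to $\mathrm{hot}(R,-)$ with $\Pi$ corresponding to $[\mathrm{Id}]$. **Backgrounds.** A background is $B=(P,m,N,\varphi)$: $P$ a graded associative unital $\Lambda$-algebra, free over $\Lambda$, with $P/\hbar P$ graded commutative; $N$ a graded left $P$-module, free over $\Lambda$; $m\in P^1$, $m^2=0$; $\varphi\in N^0$, $m\varphi=0$. Since $[P,P]\subset\hbar P$, $\frac{[\,,\,]}{\hbar}$ is defined on $P$ and, by extension, on $P\otimes A$. $\mathbf{QM}_B(A)$ is the set of $\pi\in(P\otimes\mathfrak m_A)^0$ with $\left(e^{\pi/\hbar}me^{-\pi/\hbar}-\hbar e^{\pi/\hbar}d(e^{-\pi/\hbar})\right)\varphi=0$ (terms expanded in commutators divided by $\hbar$), and $\mathbf{QFT}_B=\mathbf{QM}_B/\!\sim$. $H=H(B):=\bigoplus_i\mathbf{QFT}_B(k[\epsilon_i]/\epsilon_i^2)$ with $\deg\epsilon_i=-i$, $d\epsilon_i=0$, and $\hbar$ acting by $0$; it is a graded $k$-vector space. **Smooth formal.** If $H$ is finite dimensional with basis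 $x_1,\dots,x_r$ and dual basis $t_1,\dots,t_r$, then $\mathbf{QFT}_B$ is homotopy represented by some couple $((R,\delta),\Pi)$ with $R=\Lambda[[t_1,\dots,t_r]]$, $\delta(\mathfrak m_R)\subset\mathfrak m_R^2$, $\Pi\in\mathbf{QM}_B(R,\delta)$; $\Pi$ is called a versal solution. $B$ is smooth formal if $H$ is finite dimensional and $\delta=0$. As in the paper's expansion of $\Pi$, $\Pi$ has no terms of degree $0$ in the $t_i$. **Dirac module.** Put $U=e^{-\Pi/\hbar}$ (a power series in the $t_i$, with finitely many negative powers of $\hbar$ in each $t$-degree), so $mU\varphi=0$. Let $C_\Pi=(P\otimes R)U\varphi$, an $R$-module. Left multiplication by $m$ maps $C_\Pi$ into $\hbar C_\Pi$, and $C_\Pi$ is a complex with differential $\frac1\hbar m$. Set $D_\Pi:=H(C_\Pi,\frac1\hbar m)$. $H$ acts on $R$ and $P\otimes R$ by the $P$-linear derivations $x_i\mapsto\partial/\partial t_i$, and $\Phi^0:H\to C_\Pi$ is $\Phi^0(x)=\hbar\,x(U)\varphi$; the classes $e_i=[\Phi^0(x_i)]$ form an $R$-basis of $D_\Pi$. **Superconnection.** $\Omega^n=R\otimes S^n(H^*[1])$, $\Omega=\prod_n\Omega^n$ (Kähler forms of $R$ over $\Lambda$), $d_{dR}$ the de Rham differential, acting $P$-linearly; $\hbar d_{dR}$ acts on $C_\Pi\otimes_R\Omega$. Choose an $R$-module decomposition $C_\Pi=R\Phi^0(H)\oplus E$ with $E$ an acyclic subcomplex, and a splitting $E=E'\oplus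 F$ with $\frac1\hbar m:F\to E'$ an isomorphism. There are unique matrices of $n$-forms $A^n=((A^n)_i{}^l)$, $n\ge1$ (maps $A^n:D_\Pi\to D_\Pi\otimes_R\Omega^n$, $e_i\mapsto\sum_l(A^n)_i{}^le_l$) and maps $\Phi^n:H\to F\otimes_R\Omega^n$, $n\ge1$, such that, with $\Phi^n_i=\Phi^n(x_i)$, for all $n\ge0$ $$\hbar d_{dR}\Phi^n_i=\sum_{j=0}^n\sum_l(A^{n+1-j})_i{}^l\,\Phi^j_l+\tfrac1\hbar m\,\Phi^{n+1}_i$$ (signs from the internal grading follow the Koszul rule and are suppressed). The superconnection is $\nabla=\hbar d_{dR}+A^1+A^2+\cdots$. **Path integral.** A chain level path integral pairing for $B$ is a $k[[\hbar]]$-module map $\int:N\to k[[\hbar]]$ with $\int(\alpha\beta)\psi=\int\alpha(\beta\psi)$ for $\alpha,\beta\in P$, $\psi\in N$, and $\int m\psi=0$ for all $\psi\in N$ (Stokes axiom). It is extended $\hbar^{-1}$-linearly and $\Omega$-linearly to $C_\Pi\otimes_R\Omega$, with values in forms in which finitely many negative powers of $\hbar$ are allowed in each $t$-degree. The primary correlation form is the function $\int\Phi$ on $H$, $x\mapsto\sum_n\int\Phi^n(x)$, with values in forms; $\nabla$ acts on such a form-valued function on $H$ (a section of the dual) by the dual action, so that $\nabla\int\Phi=0$ means $\hbar d_{dR}\int\Phi=(A^1+A^2+\cdots)\int\Phi$. *)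

(* Defs.v *)
From HB Require Import structures.
From Stdlib Require Import Relation_Operators.
From mathcomp Require Import all_boot all_order all_algebra.
From mathcomp Require Import fraction zify ring.
From mathcomp Require Import boolp classical_sets functions cardinality fsbigop.
Set Implicit Arguments.
Unset Strict Implicit.
Unset Printing Implicit Defensive.
Import GRing.Theory.
Local Open Scope ring_scope.

(* k[[hbar]], by coefficients *)
Record pser (k : fieldType) := Pser { pcoef :> nat -> k }.

Section Pser.
Variable k : fieldType.
Implicit Types f g h : pser k.

HB.instance Definition _ := gen_eqMixin (pser k).
HB.instance Definition _ := gen_choiceMixin (pser k).

Lemma pserP f g : (forall n, f n = g n) <-> f = g.
Proof.
split=> [fg|-> //]; case: f g fg => f [g] /= fg.
by congr Pser; apply/funext.
Qed.

Definition padd f g := Pser (fun n => f n + g n).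
Definition popp f := Pser (fun n => - f n).
Definition pmul f g := Pser (fun n => \sum_(i < n.+1) f i * g (n - i)%N).
Definition pconst (c : k) : pser k := Pser (fun n => if n == 0%N then c else 0).

Fact paddA : associative padd.
Proof. by move=> f g h; apply/pserP => n /=; rewrite addrA. Qed.
Fact paddC : commutative padd.
Proof. by move=> f g; apply/pserP => n /=; rewrite addrC. Qed.
Fact padd0 : left_id (pconst 0) padd.
Proof. by move=> f; apply/pserP => n /=; rewrite if_same add0r. Qed.
Fact paddN : left_inverse (pconst 0) popp padd.
Proof. by move=> f; apply/pserP => n /=; rewrite if_same addNr. Qed.

HB.instance Definition _ :=
  GRing.isZmodule.Build (pser k) paddA paddC padd0 paddN.

Fact pmulC : commutative pmul.
Proof.
move=> f g; apply/pserP => n /=.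
rewrite (reindex_inj rev_ord_inj) /=; apply: eq_bigr => i _.
by rewrite mulrC subSS subKn // -ltnS.
Qed.

Fact pmulA : associative pmul.
Proof.
move=> f g h; rewrite [RHS]pmulC; apply/pserP => n /=.
pose c3 i j := f i * (g (n - i - j)%N * h j).
transitivity (\sum_(i < n.+1) \sum_(j < n.+1 | (j <= n - i)%N) c3 i j).
  apply: eq_bigr => /= i _.
  have -> : \sum_(j < (n - i).+1) g j * h (n - i - j)%N = pmul h g (n - i)%N.
    by rewrite pmulC.
  rewrite big_distrr /= (big_ord_narrow_leq (leq_subr _ _)).
  by apply: eq_bigr => j _ /=; rewrite /c3 [h _ * _]mulrC.
rewrite (exchange_big_dep predT) //=; apply: eq_bigr => j _.
transitivity (\sum_(i < n.+1 | (i <= n - j)%N) c3 i j).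
  by apply: eq_bigl => i; have := ltn_ord i; have := ltn_ord j; lia.
rewrite (big_ord_narrow_leq (leq_subr _ _)) big_distrr /=.
apply: eq_bigr => i _ /=; rewrite /c3.
by rewrite mulrA mulrC -!subnDA addnC.
Qed.

Fact pmul1 : left_id (pconst 1) pmul.
Proof.
move=> f; apply/pserP => n /=; rewrite big_ord_recl /= subn0 mul1r.
by rewrite big1 ?addr0 // => i _; rewrite mul0r.
Qed.

Fact pmulD : left_distributive pmul padd.
Proof.
move=> f g h; apply/pserP => n /=; rewrite -big_split /=.
by apply: eq_bigr => i _; rewrite mulrDl.
Qed.

Fact pone_neq0 : pconst 1 != 0.
Proof. by apply/eqP => /pserP/(_ 0%N) /eqP; rewrite /= oner_eq0. Qed.

HB.instance Definition _ := GRing.Zmodule_isComNzRing.Build (pser k)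
  pmulA pmulC pmul1 pmulD pone_neq0.

Definition punit : {pred pser k} := [pred f | `[< exists g, g * f = 1 >]].
Definition pinv f :=
  if pselect (exists g, g * f = 1) is left e then projT1 (cid e) else f.

Fact pmulV : {in punit, left_inverse 1 pinv *%R}.
Proof.
move=> f /asboolP ef; rewrite /pinv; case: pselect => // e.
by case: cid.
Qed.
Fact punitP f g : g * f = 1 -> f \in punit.
Proof. by move=> gf; apply/asboolP; exists g. Qed.
Fact pinv_out : {in [predC punit], pinv =1 id}.
Proof.
move=> f; rewrite inE /= => /asboolP nf.
by rewrite /pinv; case: pselect.
Qed.

HB.instance Definition _ := GRing.ComNzRing_hasMulInverse.Build (pser k)
  pmulV punitP pinv_out.

Fact pser_integral (f g : pser k) : f * g = 0 -> (f == 0) || (g == 0).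
Proof.
move=> fg0; apply/orP; apply: contrapT => /not_orP[/negP f0 /negP g0].
have ex h : h != 0 -> exists n, h n != 0.
  move=> h0; apply: contrapT => nh; case/negP: h0; apply/eqP/pserP => n /=.
  by rewrite if_same; apply/eqP/negP => hn; apply: nh; exists n; apply/negP.
have [a fa mina] := ex_minnP (ex _ f0); have [b gb minb] := ex_minnP (ex _ g0).
move/pserP: fg0 => /(_ (a + b)%N) /=.
have la : (a < (a + b).+1)%N by rewrite ltnS leq_addr.
rewrite (bigD1 (Ordinal la)) //= addKn big1.
  by rewrite if_same addr0 => /eqP; rewrite mulf_eq0 (negPf fa) (negPf gb).
move=> i; rewrite -val_eqE /= => ia.
case: (ltngtP i a) ia => // [lia|lai] _.
  by case: (eqVneq (f i) 0) => [->|/mina]; rewrite ?mul0r // leqNgt lia.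
case: (eqVneq (g (a + b - i)%N) 0) => [->|/minb]; rewrite ?mulr0 //.
move=> h; exfalso; move: h; apply/negP; rewrite -ltnNge.
by have := ltn_ord i; clear -lai; lia.
Qed.

HB.instance Definition _ := GRing.ComUnitRing_isIntegral.Build (pser k)
  pser_integral.

End Pser.

(* Exponents of monomials in variables indexed by I.  A monomial is written in
   the order of enum_rank, and x ^ a is admissible when no odd variable occurs
   twice. *)
Section Exponents.
Variables (I : finType) (deg : I -> int).
Implicit Types a b c : {ffun I -> nat}.

Definition oddz (z : int) : bool := odd `|z|%N.
Definition esize a : nat := \sum_i a i.
Definition edeg a : int := \sum_i deg i *+ a i.
Definition admissible a : bool := [forall i, oddz (deg i) ==> (a i <= 1)%N].
Definition ele a b : bool := [forall i, a i <= b i]%N.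
Definition eadd a b : {ffun I -> nat} := [ffun i => a i + b i]%N.
Definition esub a b : {ffun I -> nat} := [ffun i => a i - b i]%N.
Definition e0 : {ffun I -> nat} := [ffun=> 0%N].
Definition e1 i : {ffun I -> nat} := [ffun j => (j == i) : nat].
Definition below a : seq {ffun I -> nat} :=
  [seq [ffun i => (x i : nat)]
     | x : {ffun I -> 'I_(esize a).+1} <- enum {: {ffun I -> _}} & [forall i, x i <= a i]%N].

(* x ^ a * x ^ b = (-1) ^ (koszul a b) x ^ (a + b) *)
Definition koszul a b : nat :=
  \sum_i \sum_(j | (enum_rank j < enum_rank i)%N && oddz (deg i) && oddz (deg j))
    a i * b j.

Lemma in_below a b : (b \in below a) = ele b a.
Proof.
apply/mapP/idP => [[c]|/forallP ba].
  rewrite mem_filter => /andP[/forallP ca _] ->.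
  by apply/forallP => i; rewrite ffunE.
have bs i : (b i < (esize a).+1)%N.
  by rewrite ltnS /esize (bigD1 i) //= (leq_trans (ba i)) // leq_addr.
exists [ffun i => Ordinal (bs i)]; last by apply/ffunP => i; rewrite !ffunE.
rewrite mem_filter mem_enum andbT.
by apply/forallP => i; rewrite ffunE /= ba.
Qed.

Lemma below_uniq a : uniq (below a).
Proof.
rewrite map_inj_uniq; first exact/filter_uniq/enum_uniq.
move=> b c /ffunP bc.
by apply/ffunP => i; apply/val_inj; have := bc i; rewrite !ffunE.
Qed.

Lemma koszulDl a b c : koszul (eadd a b) c = (koszul a c + koszul b c)%N.
Proof.
rewrite /koszul -big_split; apply: eq_bigr => i _; rewrite -big_split.
by apply: eq_bigr => j _; rewrite ffunE mulnDl.
Qed.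

Lemma koszulDr a b c : koszul a (eadd b c) = (koszul a b + koszul a c)%N.
Proof.
rewrite /koszul -big_split; apply: eq_bigr => i _; rewrite -big_split.
by apply: eq_bigr => j _; rewrite ffunE mulnDr.
Qed.

Lemma koszul0e a : koszul e0 a = 0%N.
Proof. by apply: big1 => i _; apply: big1 => j _; rewrite ffunE. Qed.

Lemma koszule0 a : koszul a e0 = 0%N.
Proof. by apply: big1 => i _; apply: big1 => j _; rewrite ffunE muln0. Qed.

Lemma esubK a b : ele b a -> eadd b (esub a b) = a.
Proof. by move=> /forallP ba; apply/ffunP => i; rewrite !ffunE subnKC. Qed.

Lemma esub_le a b : ele (esub a b) a.
Proof. by apply/forallP => i; rewrite ffunE leq_subr. Qed.

Lemma esub0 a : esub a e0 = a.
Proof. by apply/ffunP => i; rewrite !ffunE subn0. Qed.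

Lemma esubb a : esub a a = e0.
Proof. by apply/ffunP => i; rewrite !ffunE subnn. Qed.

Lemma ele_trans a b c : ele a b -> ele b c -> ele a c.
Proof.
by move=> /forallP ab /forallP bc; apply/forallP => i; apply: leq_trans (bc i).
Qed.

Lemma elee a : ele a a. Proof. exact/forallP. Qed.
Lemma ele0 a : ele e0 a. Proof. by apply/forallP => i; rewrite ffunE. Qed.

Lemma ele_adm a b : ele b a -> admissible a -> admissible b.
Proof.
move=> /forallP ba /forallP aa; apply/forallP => i; apply/implyP => oi.
by apply: leq_trans (ba i) _; have := aa i; rewrite oi.
Qed.

Lemma adm0 : admissible e0.
Proof. by apply/forallP => i; rewrite ffunE implybT. Qed.

Lemma eaddA a b c : eadd a (eadd b c) = eadd (eadd a b) c.
Proof. by apply/ffunP => i; rewrite !ffunE addnA. Qed.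

Lemma eaddIl a b : esub (eadd a b) a = b.
Proof. by apply/ffunP => i; rewrite !ffunE addKn. Qed.

Lemma ele_addl a b : ele a (eadd a b).
Proof. by apply/forallP => i; rewrite ffunE leq_addr. Qed.

Lemma esubA a b c : ele c b -> ele b a ->
  esub (esub a c) (esub b c) = esub a b.
Proof.
move=> /forallP cb /forallP ba; apply/ffunP => i; rewrite !ffunE.
by have := cb i; have := ba i; lia.
Qed.

Lemma big_below2 (V : nmodType) (F : {ffun I -> nat} -> {ffun I -> nat} ->
    {ffun I -> nat} -> V) a :
  \sum_(b <- below a) \sum_(c <- below b) F c (esub b c) (esub a b) =
  \sum_(c <- below a) \sum_(d <- below (esub a c)) F c d (esub (esub a c) d).
Proof.
pose G (x : {ffun I -> nat} * {ffun I -> nat} * {ffun I -> nat}) :=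
  F x.1.1 x.1.2 x.2.
transitivity (\sum_(x <- [seq (c, esub b c, esub a b)
    | b <- below a, c <- below b]) G x); first by rewrite big_allpairs_dep.
transitivity (\sum_(x <- [seq (c, d, esub (esub a c) d)
    | c <- below a, d <- below (esub a c)]) G x); last by rewrite big_allpairs_dep.
apply: perm_big; apply: uniq_perm.
- apply: allpairs_uniq_dep => [|b _|]; rewrite ?below_uniq //.
  move=> _ _ /allpairsPdep[b [c [_ cb ->]]] /allpairsPdep[b' [c' [_ cb' ->]]] /=.
  move: cb cb'; rewrite !in_below => /esubK cb /esubK cb' [cc bc _].
  by rewrite -cb -cb' bc cc.
- apply: allpairs_uniq_dep => [|b _|]; rewrite ?below_uniq //.
  by move=> _ _ /allpairsPdep[b [c [_ _ ->]]] /allpairsPdep[b' [c' [_ _ ->]]] [-> ->].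
move=> [[x y] z]; apply/allpairsPdep/allpairsPdep.
  move=> [b [c []]]; rewrite !in_below => ba cb [-> -> ->].
  exists c, (esub b c); rewrite !in_below esubA //; split=> //.
    exact: ele_trans cb ba.
  apply/forallP => i; rewrite !ffunE.
  by have /forallP/(_ i) := cb; have /forallP/(_ i) := ba; lia.
move=> [c [d []]]; rewrite !in_below => ca da [-> -> ->].
exists (eadd c d), c; rewrite !in_below eaddIl ele_addl; split=> //.
  apply/forallP => i; rewrite !ffunE.
  by have /forallP/(_ i) := ca; have /forallP/(_ i) := da; rewrite ffunE; lia.
by congr (_, _, _); apply/ffunP => i; rewrite !ffunE subnDA.
Qed.

End Exponents.

(* Graded commutative power series in the variables I over C. *)
Record gps (C : comNzRingType) (I : finType) (deg : I -> int) := Gps {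
  gcoef :> {ffun I -> nat} -> C;
  _ : forall a, ~~ admissible deg a -> gcoef a = 0 }.

Section Gps.
Variables (C : comNzRingType) (I : finType) (deg : I -> int).
Local Notation G := (gps C deg).
Implicit Types (f g h : G) (a b c : {ffun I -> nat}).

HB.instance Definition _ := gen_eqMixin G.
HB.instance Definition _ := gen_choiceMixin G.

Lemma gpsP f g : (forall a, f a = g a) <-> f = g.
Proof.
split=> [fg|-> //]; case: f g fg => f pf [g pg] /= /funext fg.
by case: g / fg in pg *; congr Gps; exact: Prop_irrelevance.
Qed.

Lemma gps_out f a : ~~ admissible deg a -> f a = 0.
Proof. by case: f => f0 p /= /p. Qed.

Fact mkgps_subproof (F : {ffun I -> nat} -> C) a :
  ~~ admissible deg a -> (if admissible deg a then F a else 0) = 0.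
Proof. by move/negPf ->. Qed.
Definition mkgps F : G := Gps (@mkgps_subproof F).

Definition gadd f g := mkgps (fun a => f a + g a).
Definition gopp f := mkgps (fun a => - f a).
Definition gscale (x : C) f := mkgps (fun a => x * f a).
Definition gconst (x : C) : G := mkgps (fun a => if a == e0 I then x else 0).
Definition gmul f g := mkgps (fun a =>
  \sum_(b <- below a) (-1) ^+ koszul deg b (esub a b) * (f b * g (esub a b))).

Lemma gaddE f g a : gadd f g a = f a + g a.
Proof. by rewrite /=; case: ifPn => // na; rewrite !gps_out // addr0. Qed.
Lemma goppE f a : gopp f a = - f a.
Proof. by rewrite /=; case: ifPn => // na; rewrite !gps_out // oppr0. Qed.
Lemma gscaleE x f a : gscale x f a = x * f a.
Proof. by rewrite /=; case: ifPn => // na; rewrite !gps_out // mulr0. Qed.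
Lemma gconstE (x : C) a : gconst x a = if a == e0 I then x else 0.
Proof.
by rewrite /=; case: ifPn => //; case: eqP => // -> /negP[]; apply: adm0.
Qed.
Lemma gmulE f g a : admissible deg a -> gmul f g a =
  \sum_(b <- below a) (-1) ^+ koszul deg b (esub a b) * (f b * g (esub a b)).
Proof. by rewrite /= => ->. Qed.


Fact gaddA : associative gadd.
Proof. by move=> f g h; apply/gpsP => n; rewrite !gaddE addrA. Qed.
Fact gaddC : commutative gadd.
Proof. by move=> f g; apply/gpsP => n; rewrite !gaddE addrC. Qed.
Fact gadd0 : left_id (gconst 0) gadd.
Proof. by move=> f; apply/gpsP => n; rewrite gaddE gconstE if_same add0r. Qed.
Fact gaddN : left_inverse (gconst 0) gopp gadd.
Proof.
by move=> f; apply/gpsP => n; rewrite gaddE goppE gconstE if_same addNr.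
Qed.

HB.instance Definition _ := GRing.isZmodule.Build G gaddA gaddC gadd0 gaddN.

Fact gmulA : associative gmul.
Proof.
move=> f g h; apply/gpsP => a; case: (boolP (admissible deg a)) => aa; last first.
  by rewrite !gps_out.
pose F x y z := (-1) ^+ koszul deg x (eadd y z) * (f x *
  ((-1) ^+ koszul deg y z * (g y * h z))).
have leP b : b \in below a -> admissible deg b.
  by rewrite in_below => ba; apply: ele_adm ba aa.
have subP b : admissible deg (esub a b) by apply: ele_adm (esub_le _ _) aa.
transitivity (\sum_(c <- below a) \sum_(d <- below (esub a c))
    F c d (esub (esub a c) d)).
  rewrite gmulE //; apply: eq_bigr => b _.
  rewrite gmulE // !big_distrr /=; apply: eq_big_seq => d.
  by rewrite in_below => da; rewrite /F esubK.
rewrite -(big_below2 F) gmulE //; apply: eq_big_seq => b ba.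
rewrite gmulE ?leP // big_distrl big_distrr /=; apply: eq_big_seq => c.
rewrite in_below => cb; rewrite /F koszulDr.
have -> : koszul deg b (esub a b) =
    (koszul deg c (esub a b) + koszul deg (esub b c) (esub a b))%N.
  by rewrite -koszulDl esubK.
by rewrite !exprD; ring.
Qed.

Fact gmul1l : left_id (gconst 1) gmul.
Proof.
move=> f; apply/gpsP => a; case: (boolP (admissible deg a)) => aa; last first.
  by rewrite !gps_out.
rewrite gmulE // (bigD1_seq (e0 I)) ?in_below ?ele0 ?below_uniq //.
rewrite gconstE eqxx koszul0e expr0 !mul1r esub0.
rewrite big1 => [|b /negPf b0]; first exact: addr0.
by rewrite gconstE b0 mul0r mulr0.
Qed.

Fact gmul1r : right_id (gconst 1) gmul.
Proof.
move=> f; apply/gpsP => a; case: (boolP (admissible deg a)) => aa; last first.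
  by rewrite !gps_out.
rewrite gmulE // (bigD1_seq a) ?in_below ?elee ?below_uniq //.
rewrite esubb gconstE eqxx koszule0 expr0 mulr1 mul1r.
rewrite big_seq_cond big1 => [|b]; first exact: addr0.
rewrite in_below => /andP[ba nba].
rewrite gconstE.
case: eqP => [ab|]; last by rewrite !mulr0.
case/negP: nba; rewrite -(esubK ba) ab.
by apply/eqP/ffunP => i; rewrite !ffunE addn0.
Qed.

Fact gmulDl : left_distributive gmul gadd.
Proof.
move=> f g h; apply/gpsP => a; case: (boolP (admissible deg a)) => aa; last first.
  by rewrite !gps_out.
rewrite gaddE !gmulE // -big_split; apply: eq_bigr => b _.
by rewrite gaddE mulrDl mulrDr.
Qed.

Fact gmulDr : right_distributive gmul gadd.
Proof.
move=> f g h; apply/gpsP => a; case: (boolP (admissible deg a)) => aa; last first.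
  by rewrite !gps_out.
rewrite gaddE !gmulE // -big_split; apply: eq_bigr => b _.
by rewrite gaddE mulrDr mulrDr.
Qed.

Fact gone_neq0 : gconst 1 != 0.
Proof.
apply/eqP => /gpsP/(_ (e0 I)); rewrite !gconstE eqxx => /eqP.
by rewrite oner_eq0.
Qed.

HB.instance Definition _ := GRing.Zmodule_isNzRing.Build G
  gmulA gmul1l gmul1r gmulDl gmulDr gone_neq0.

Fact gscaleA x y f : gscale x (gscale y f) = gscale (x * y) f.
Proof. by apply/gpsP => a; rewrite !gscaleE mulrA. Qed.
Fact gscale1 : left_id 1 gscale.
Proof. by move=> f; apply/gpsP => a; rewrite gscaleE mul1r. Qed.
Fact gscaleDr : right_distributive gscale +%R.
Proof.
by move=> x f g; apply/gpsP => a; rewrite !(gscaleE, gaddE) mulrDr.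
Qed.
Fact gscaleDl f : {morph gscale^~ f : x y / x + y}.
Proof. by move=> x y; apply/gpsP => a; rewrite !(gscaleE, gaddE) mulrDl. Qed.

HB.instance Definition _ := GRing.Zmodule_isLmodule.Build C G
  gscaleA gscale1 gscaleDr gscaleDl.

Fact gscaleAl x f g : x *: (f * g) = (x *: f) * g.
Proof.
apply/gpsP => a; case: (boolP (admissible deg a)) => aa; last first.
  by rewrite !gps_out.
rewrite gscaleE !gmulE // mulr_sumr; apply: eq_bigr => b _.
by rewrite gscaleE; ring.
Qed.

HB.instance Definition _ := GRing.Lmodule_isLalgebra.Build C G gscaleAl.

Fact gscaleAr x f g : x *: (f * g) = f * (x *: g).
Proof.
apply/gpsP => a; case: (boolP (admissible deg a)) => aa; last first.
  by rewrite !gps_out.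
rewrite gscaleE !gmulE // mulr_sumr; apply: eq_bigr => b _.
by rewrite gscaleE; ring.
Qed.

HB.instance Definition _ := GRing.Lalgebra_isAlgebra.Build C G gscaleAr.

Definition gvar i : G := mkgps (fun a => (a == e1 i)%:R).

(* Left derivative: x ^ (a + e1 i) = (-1) ^ (koszul (e1 i) a) x_i x ^ a. *)
Definition gder i f : G := mkgps (fun a =>
  (-1) ^+ koszul deg (e1 i) a * ((a i).+1%:R * f (eadd a (e1 i)))).

Definition gsign f : G := mkgps (fun a => (-1) ^+ oddz (edeg deg a) * f a).
Definition gpart (z : int) f : G :=
  mkgps (fun a => if edeg deg a == z then f a else 0).

End Gps.

Section PserOps.
Variable k : fieldType.

Definition hbar : pser k := Pser (fun n => (n == 1%N)%:R).
(* f / hbar when f is divisible by hbar *)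
Definition pdivh (f : pser k) : pser k := Pser (fun n => f n.+1).

End PserOps.
Arguments hbar {k}.

(* An algebra over k[[hbar]] with candidate homogeneous components, differential
   and residue map; the axioms are in artin.  Morphisms also make sense out of
   complete algebras, such as Rdg below. *)
Record dgalg (k : fieldType) := DGAlg {
  dgsort :> algType (pser k);
  dgcomp : int -> dgsort -> dgsort;
  dgd : dgsort -> dgsort;
  dgaug : dgsort -> k }.

Section ParamRings.
Variable k : fieldType.
Implicit Types A B : dgalg k.

Definition dghom A (z : int) (a : A) : Prop := dgcomp z a = a.
Definition dgsign A (a : A) : A :=
  \sum_(z \in [set: int]) (-1) ^+ oddz z * dgcomp z a.

(* The objects of the category C_Lambda. *)
Record artin A : Prop := Artin {
  artin_comp_lin : forall z (c : pser k) (a b : A),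
    dgcomp z (c *: a + b) = c *: dgcomp z a + dgcomp z b;
  artin_comp_proj : forall z w (a : A),
    dgcomp z (dgcomp w a) = if z == w then dgcomp z a else 0;
  artin_comp_sum : forall a : A,
    exists2 s : seq int, uniq s & a = \sum_(z <- s) dgcomp z a;
  artin_one : dghom 0 (1 : A);
  artin_mul : forall z w (a b : A),
    dghom z a -> dghom w b -> dghom (z + w) (a * b);
  artin_comm : forall z w (a b : A),
    dghom z a -> dghom w b -> a * b = (-1) ^+ (oddz z && oddz w) * (b * a);
  artin_d_lin : forall (c : pser k) (a b : A),
    dgd (c *: a + b) = c *: dgd a + dgd b;
  artin_d_deg : forall z (a : A), dghom z a -> dghom (z + 1) (dgd a);
  artin_d_mul : forall z (a b : A),
    dghom z a -> dgd (a * b) = dgd a * b + (-1) ^+ oddz z * (a * dgd b);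
  artin_dd : forall a : A, dgd (dgd a) = 0;
  artin_one_nexact : forall a : A, dgd a <> 1;
  artin_aug_add : forall a b : A, dgaug (a + b) = dgaug a + dgaug b;
  artin_aug_one : dgaug (1 : A) = 1;
  artin_aug_mul : forall a b : A, dgaug (a * b) = dgaug a * dgaug b;
  artin_aug_scale : forall (c : pser k) (a : A), dgaug (c *: a) = c 0%N * dgaug a;
  artin_nilp : exists n : nat, forall s : seq A,
    (forall a, a \in s -> dgaug a = 0) -> (n <= size s)%N -> \prod_(a <- s) a = 0;
  artin_findim : exists (n : nat) (v : 'I_n -> A), forall a : A,
    dgaug a = 0 -> exists c : 'I_n -> k, a = \sum_i pconst (c i) *: v i }.

Record dgmor A B (f : A -> B) : Prop := DGMor {
  dgmor_lin : forall (c : pser k) (a b : A), f (c *: a + b) = c *: f a + f b;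
  dgmor_one : f 1 = 1;
  dgmor_mul : forall a b : A, f (a * b) = f a * f b;
  dgmor_deg : forall z (a : A), dghom z a -> dghom z (f a);
  dgmor_aug : forall a : A, dgaug (f a) = dgaug a;
  dgmor_d : forall a : A, f (dgd a) = dgd (f a) }.

(* A (x) k[u, v]: the pair (p, q) stands for p(u) + q(u) v. *)
Definition pathT A := ({poly A} * {poly A})%type.
Definition path_mul A (x y : pathT A) : pathT A :=
  (x.1 * y.1, x.1 * y.2 + x.2 * map_poly (@dgsign A) y.1).
Definition path_d A (x : pathT A) : pathT A :=
  (map_poly (@dgd k A) x.1,
   map_poly (@dgsign A) x.1^`() + map_poly (@dgd k A) x.2).

(* A' is, through iota, an Artin subalgebra of A (x) k[u, v] whose maximal ideal
   lies in m_A (x) k[u, v]. *)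
Record path_subalg A A' (iota : A' -> pathT A) : Prop := PathSubalg {
  path_artin : artin A';
  path_inj : injective iota;
  path_lin : forall (c : pser k) (a b : A'), iota (c *: a + b) =
    (c%:A *: (iota a).1 + (iota b).1, c%:A *: (iota a).2 + (iota b).2);
  path_one : iota 1 = (1, 0);
  path_mulP : forall a b : A', iota (a * b) = path_mul (iota a) (iota b);
  path_deg : forall z (a : A'), dghom z a -> forall i : nat,
    dghom z (iota a).1`_i /\ dghom (z - 1) (iota a).2`_i;
  path_dP : forall a : A', iota (dgd a) = path_d (iota a);
  path_aug : forall a : A', dgaug a = 0 -> forall i : nat,
    dgaug (iota a).1`_i = 0 /\ dgaug (iota a).2`_i = 0 }.

Definition path_ev A (t : A) (x : pathT A) : A := x.1.[t].

Definition mor_htp A B (f0 f1 : A -> B) : Prop :=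
  exists (B' : dgalg k) (iota : B' -> pathT B) (f : A -> B'),
    [/\ path_subalg iota, dgmor f,
        forall a, f0 a = path_ev 0 (iota (f a)) &
        forall a, f1 a = path_ev 1 (iota (f a))].

(* f0 and f1 have the same class in hot(A, B) *)
Definition hot_eq A B : (A -> B) -> (A -> B) -> Prop :=
  clos_refl_sym_trans (A -> B) (@mor_htp A B).

End ParamRings.

(* A graded free module, with a homogeneous basis and its coordinates. *)
Record gfree (k : fieldType) (M : lmodType (pser k)) := GFree {
  gidx : choiceType;
  gdeg : gidx -> int;
  gbas : gidx -> M;
  gco : M -> gidx -> pser k;
  gco_lin : forall s c x y, gco (c *: x + y) s = c * gco x s + gco y s;
  gco_fin : forall x, finite_set [set s | gco x s != 0];
  gco_bas : forall s u, gco (gbas s) u = (s == u)%:R;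
  gco_sum : forall x, x = \sum_(s \in [set: gidx]) gco x s *: gbas s }.

Definition ghom (k : fieldType) (M : lmodType (pser k)) (F : gfree M) (z : int)
    (x : M) : Prop := forall s : gidx F, gco x s != 0 -> gdeg s = z.

Record background (k : fieldType) := Background {
  bP : algType (pser k);
  bPf : gfree bP;
  bN : lmodType (pser k);
  bNf : gfree bN;
  bact : bP -> bN -> bN;
  bm : bP;
  bphi : bN;
  bP_one : ghom bPf 0 1;
  bP_mul : forall z w x y,
    ghom bPf z x -> ghom bPf w y -> ghom bPf (z + w) (x * y);
  bP_comm : forall z w x y, ghom bPf z x -> ghom bPf w y ->
    exists p, x * y - (-1) ^+ (oddz z && oddz w) * (y * x) = hbar *: p;
  bact_linl : forall c x y n, bact (c *: x + y) n = c *: bact x n + bact y n;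
  bact_linr : forall c x n p, bact x (c *: n + p) = c *: bact x n + bact x p;
  bact_one : forall n, bact 1 n = n;
  bact_mul : forall x y n, bact (x * y) n = bact x (bact y n);
  bact_deg : forall z w x n,
    ghom bPf z x -> ghom bNf w n -> ghom bNf (z + w) (bact x n);
  bm_deg : ghom bPf 1 bm;
  bm_sq : bm * bm = 0;
  bphi_deg : ghom bNf 0 bphi;
  bm_phi : bact bm bphi = 0 }.

Section QuantumMaster.
Variables (k : fieldType) (B : background k).
Local Notation S := (gidx (bPf B)).
Local Notation T := (gidx (bNf B)).

(* An element sum_s b_s (x) pi_s of P (x) A, written with its coefficients on the
   left, is the function pi : S -> A. *)

Definition bcomm (s u : S) : bP B :=
  gbas s * gbas u - (-1) ^+ (oddz (gdeg s) && oddz (gdeg u)) * (gbas u * gbas s).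

(* [f, g] / hbar in P (x) A; the sign moves the basis vector of f past the
   coefficient of g. *)
Definition bracket (A : dgalg k) (f g : S -> A) : S -> A := fun w =>
  \sum_(p \in [set: S * S]) pdivh (gco (bcomm p.1 p.2) w) *:
    (f p.1 * (if oddz (gdeg p.1) then dgsign (g p.2) else g p.2)).

(* With X = pi / hbar, e^X m e^-X is the sum of the ad(X)^n m / n!, and
   - hbar e^X d(e^-X) that of the ad(X)^n (d pi) / (n + 1)!. *)
Definition mc_term (A : dgalg k) (pi : S -> A) (n : nat) : S -> A := fun s =>
  pconst (n`!%:R^-1) *: iter n (bracket pi) (fun u => (gco (bm B) u)%:A) s +
  pconst (n.+1`!%:R^-1) *: iter n (bracket pi) (fun u => dgd (pi u)) s.

Definition mc_sum (A : dgalg k) (pi : S -> A) (n : nat) : T -> A := fun t =>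
  \sum_(s \in [set: S])
    gco (bact (gbas s) (bphi B)) t *: \sum_(i < n) mc_term pi i s.

Definition QM (A : dgalg k) (pi : S -> A) : Prop :=
  [/\ finite_set [set s | pi s != 0],
      forall s, dgaug (pi s) = 0,
      forall s, dghom (- gdeg s) (pi s) &
      exists n0, forall n, (n0 <= n)%N -> forall t, mc_sum pi n t = 0].

Definition QM_htp (A : dgalg k) (pi0 pi1 : S -> A) : Prop :=
  exists (A' : dgalg k) (iota : A' -> pathT A) (xi : S -> A'),
    [/\ path_subalg iota, QM xi,
        forall s, pi0 s = path_ev 0 (iota (xi s)) &
        forall s, pi1 s = path_ev 1 (iota (xi s))].

(* pi0 and pi1 have the same class in QFT(A) *)
Definition QFT_eq (A : dgalg k) : (S -> A) -> (S -> A) -> Prop :=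
  clos_refl_sym_trans (S -> A) (@QM_htp A).

End QuantumMaster.

(* k[epsilon] / epsilon ^ 2, with (a, b) standing for a + b epsilon. *)
Definition dualn (k : fieldType) := (k * k)%type.

Section DualNumbers.
Variable k : fieldType.
Implicit Types x y z : dualn k.

HB.instance Definition _ := GRing.Zmodule.on (dualn k).

Definition dual_one : dualn k := (1, 0).
Definition dual_mul x y : dualn k := (x.1 * y.1, x.1 * y.2 + x.2 * y.1).
Definition dual_scale (c : pser k) x : dualn k := (c 0%N * x.1, c 0%N * x.2).

Fact dual_mulA : associative dual_mul.
Proof. by move=> x y z; congr (_, _) => /=; ring. Qed.
Fact dual_mulC : commutative dual_mul.
Proof. by move=> x y; congr (_, _) => /=; ring. Qed.
Fact dual_mul1 : left_id dual_one dual_mul.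
Proof. by move=> [a b]; congr (_, _) => /=; ring. Qed.
Fact dual_mulD : left_distributive dual_mul +%R.
Proof. by move=> x y z; congr (_, _) => /=; ring. Qed.
Fact dual_one_neq0 : dual_one != 0.
Proof. by apply/eqP => -[] /eqP; rewrite oner_eq0. Qed.

HB.instance Definition _ := GRing.Zmodule_isComNzRing.Build (dualn k)
  dual_mulA dual_mulC dual_mul1 dual_mulD dual_one_neq0.

Lemma pcoef0M (c d : pser k) : (c * d) 0%N = c 0%N * d 0%N.
Proof. by rewrite /= big_ord_recl big_ord0 addr0. Qed.

Fact dual_scaleA c d x : dual_scale c (dual_scale d x) = dual_scale (c * d) x.
Proof. by rewrite /dual_scale pcoef0M !mulrA. Qed.
Fact dual_scale1 : left_id 1 dual_scale.
Proof. by move=> [a b]; congr (_, _); rewrite /= mul1r. Qed.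
Fact dual_scaleDr : right_distributive dual_scale +%R.
Proof. by move=> c x y; congr (_, _); rewrite /= mulrDr. Qed.
Fact dual_scaleDl x : {morph dual_scale^~ x : c d / c + d}.
Proof. by move=> c d; congr (_, _); rewrite /= mulrDl. Qed.

HB.instance Definition _ := GRing.Zmodule_isLmodule.Build (pser k) (dualn k)
  dual_scaleA dual_scale1 dual_scaleDr dual_scaleDl.

Fact dual_scaleAl (c : pser k) x y : c *: (x * y) = (c *: x) * y.
Proof. by congr (_, _) => /=; ring. Qed.
HB.instance Definition _ :=
  GRing.Lmodule_isLalgebra.Build (pser k) (dualn k) dual_scaleAl.
HB.instance Definition _ := GRing.Lalgebra_isComAlgebra.Build (pser k) (dualn k).

(* epsilon has degree - j, d = 0 and hbar acts by 0 *)
Definition dual_comp (j z : int) x : dualn k :=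
  ((if z == 0 then x.1 else 0), (if z == - j then x.2 else 0)).
Definition dual_dg (j : int) : dgalg k :=
  @DGAlg k (dualn k) (dual_comp j) (fun=> 0) fst.

End DualNumbers.

Section Versal.
Variables (k : fieldType) (B : background k) (r : nat) (d : 'I_r -> int).
Local Notation S := (gidx (bPf B)).

(* The classes of x_1, ..., x_r, with x_i in degree d i, form a basis of H(B);
   the linear structure of H(B) is induced from the representatives. *)
Definition H_basis (x : 'I_r -> S -> dualn k) : Prop :=
  (forall i, @QM k B (dual_dg k (d i)) (x i)) /\
  forall (j : int) (pi : S -> dual_dg k j), QM pi ->
    exists! c : 'I_r -> k,
      (forall i, d i != j -> c i = 0) /\
      QFT_eq pi (fun s => \sum_i pconst (c i) *: (x i s : dual_dg k j)).

Definition tdeg (i : 'I_r) : int := - d i.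

(* R = k[[hbar]][[t_1, ..., t_r]] with differential 0 *)
Definition Rdg : dgalg k :=
  @DGAlg k (gps (pser k) tdeg) (@gpart (pser k) _ tdeg) (fun=> 0)
    (fun f => f (e0 'I_r) 0%N).

(* The j-th power of the maximal ideal (hbar, t_1, ..., t_r) of R. *)
Definition in_mR (j : nat) (f : Rdg) : Prop :=
  forall (a : {ffun 'I_r -> nat}) n, (esize a + n < j)%N ->
    (f : gps (pser k) tdeg) a n = 0.

(* P (x) R, as functions S -> R *)
Definition PR (p : S -> Rdg) : Prop :=
  forall j, finite_set [set s | ~ in_mR j (p s)].

(* QM(R) is the inverse limit of QM over the Artin quotients of R. *)
Record QM_R (Pi : S -> Rdg) : Prop := QMR {
  QMR_PR : PR Pi;
  QMR_aug : forall s, dgaug (Pi s) = 0;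
  QMR_deg : forall s, dghom (- gdeg s) (Pi s);
  QMR_lim : forall (A : dgalg k) (f : Rdg -> A),
    artin A -> dgmor f -> QM (fun s => f (Pi s)) }.

Record homotopy_represents (Pi : S -> Rdg) : Prop := HomotopyRepresents {
  hrep_functor : forall (A A1 : dgalg k) (f : A -> A1) (pi0 pi1 : S -> A),
    artin A -> artin A1 -> dgmor f -> QM pi0 -> QM pi1 ->
    QFT_eq pi0 pi1 -> QFT_eq (fun s => f (pi0 s)) (fun s => f (pi1 s));
  hrep_htp : forall (A A1 : dgalg k) (f0 f1 : A -> A1) (pi : S -> A),
    artin A -> artin A1 -> dgmor f0 -> dgmor f1 -> QM pi ->
    hot_eq f0 f1 -> QFT_eq (fun s => f0 (pi s)) (fun s => f1 (pi s));
  hrep_inj : forall (A : dgalg k) (f0 f1 : Rdg -> A),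
    artin A -> dgmor f0 -> dgmor f1 ->
    hot_eq f0 f1 <-> QFT_eq (fun s => f0 (Pi s)) (fun s => f1 (Pi s));
  hrep_surj : forall (A : dgalg k) (pi : S -> A), artin A -> QM pi ->
    exists2 f : Rdg -> A, dgmor f & QFT_eq (fun s => f (Pi s)) pi }.

(* B is smooth formal, with H(B) of basis x and versal solution Pi. *)
Record smooth_formal (x : 'I_r -> S -> dualn k) (Pi : S -> Rdg) : Prop :=
  SmoothFormal {
    sf_basis : H_basis x;
    sf_QM : QM_R Pi;
    sf_rep : homotopy_represents Pi;
    sf_const : forall s, (Pi s : gps (pser k) tdeg) (e0 'I_r) = 0 }.

End Versal.

(* Convergent sums in k((hbar)), for the hbar-adic topology. *)
Section Summation.
Variable k : fieldType.
Local Notation K := {fraction (pser k)}.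

Definition hadic (j : nat) (x : K) : Prop :=
  exists l : pser k, x = tofrac (hbar ^+ j * l).

Definition is_hsum (J : choiceType) (f : J -> K) (x : K) : Prop :=
  forall j, exists s : seq J, forall u : seq J, uniq u -> {subset s <= u} ->
    hadic j (x - \sum_(i <- u) f i).

Definition hsum (J : choiceType) (f : J -> K) : K := xget 0 (is_hsum f).

End Summation.

Section Superconnection.
Variables (k : fieldType) (B : background k) (r : nat) (d : 'I_r -> int).
Local Notation K := {fraction (pser k)}.
Local Notation S := (gidx (bPf B)).
Local Notation T := (gidx (bNf B)).
Local Notation R := (gps (pser k) (tdeg d)).

(* The variables are inl i = t_i, of degree - d i, and inr i = dt_i, the same
   element of H^* regarded in H^*[1]. *)
Definition vdeg (v : 'I_r + 'I_r) : int :=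
  match v with inl i => - d i | inr i => - d i - 1 end.

Definition Omega := gps (pser k) vdeg.
(* Forms with finitely many negative powers of hbar in each t-degree. *)
Definition OmegaK := gps K vdeg.

HB.instance Definition _ := GRing.NzRing.on Omega.
HB.instance Definition _ := GRing.Algebra.on OmegaK.

Definition fdeg (a : {ffun 'I_r + 'I_r -> nat}) : nat := \sum_(i < r) a (inr i).

Definition is_form (n : nat) (w : Omega) : Prop :=
  forall a, w a != 0 -> fdeg a = n.

Definition of_R (f : R) : OmegaK := mkgps vdeg (fun a =>
  if fdeg a == 0%N then tofrac (f [ffun i : 'I_r => a (inl i)]) else 0).
Definition of_Omega (w : Omega) : OmegaK := mkgps vdeg (fun a => tofrac (w a)).

Definition hK : K := tofrac hbar.

Definition d_dR (w : OmegaK) : OmegaK :=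
  \sum_i gvar K vdeg (inr i) * gder (inl i) w.

Definition wsum (J : choiceType) (f : J -> OmegaK) : OmegaK :=
  mkgps vdeg (fun a => hsum (fun j => f j a)).

(* Extended elements of P and N are functions S -> OmegaK and T -> OmegaK giving
   the coordinates, with forms on the left of basis vectors.  By Koszul, operators
   acting on forms only act on the coordinates without sign. *)

Definition ext_cst (M : lmodType (pser k)) (F : gfree M) (x : M) :
  gidx F -> OmegaK := fun s => (tofrac (gco x s))%:A.

Arguments ext_cst [M] F x.

Definition ext_bilin (M1 M2 M3 : lmodType (pser k)) (F1 : gfree M1)
    (F2 : gfree M2) (F3 : gfree M3) (beta : M1 -> M2 -> M3)
    (x : gidx F1 -> OmegaK) (y : gidx F2 -> OmegaK) : gidx F3 -> OmegaK := fun w =>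
  wsum (fun p : gidx F1 * gidx F2 =>
    tofrac (gco (beta (gbas p.1) (gbas p.2)) w) *:
      (x p.1 * (if oddz (gdeg p.1) then gsign (y p.2) else y p.2))).

Definition Pmul : (S -> OmegaK) -> (S -> OmegaK) -> S -> OmegaK :=
  ext_bilin (F1 := bPf B) (F2 := bPf B) (F3 := bPf B) *%R.
Definition Pact : (S -> OmegaK) -> (T -> OmegaK) -> T -> OmegaK :=
  ext_bilin (F1 := bPf B) (F2 := bNf B) (F3 := bNf B) (@bact k B).

(* N (x) Omega with hbar inverted: the coefficient of each monomial lies in the
   hbar-adic completion of N with hbar inverted. *)
Definition in_N (nu : T -> OmegaK) : Prop :=
  forall a j, finite_set [set t | ~ hadic j (nu t a)].

Definition m_h (nu : T -> OmegaK) : T -> OmegaK := fun t =>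
  hK^-1 *: Pact (ext_cst (bPf B) (bm B)) nu t.

Section Dirac.
Variable Pi : S -> Rdg k d.

(* exp (- Pi / hbar); as Pi has no constant term, the n-th term of the exponential
   has t-degree at least n. *)
Definition U : S -> OmegaK := fun s => mkgps vdeg (fun a =>
  \sum_(n < (esize a).+1) n`!%:R^-1 *
    iter n (Pmul (fun u => - hK^-1 *: of_R (Pi u))) (ext_cst (bPf B) 1) s a).

Definition phiN : T -> OmegaK := ext_cst (bNf B) (bphi B).

(* in_N only names the ambient module: every such product satisfies it. *)
Definition C_Pi : set (T -> OmegaK) := [set nu | in_N nu /\
  exists2 p : S -> Rdg k d, PR p &
    nu = Pact (fun s => of_R (p s)) (Pact U phiN)].

Definition Phi0 (i : 'I_r) : T -> OmegaK := fun t =>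
  hK *: Pact (fun s => gder (inl i) (U s)) phiN t.

Definition Npart (z : int) (nu : T -> OmegaK) : T -> OmegaK := fun t =>
  gpart (z - gdeg t) (nu t).

Record submodR (E : set (T -> OmegaK)) : Prop := SubmodR {
  submodR0 : E (fun=> 0);
  submodRD : forall x y, E x -> E y -> E (fun t => x t + y t);
  submodRM : forall (f : R) x, E x -> E (fun t => of_R f * x t);
  submodR_part : forall z x, E x -> E (Npart z x) }.

(* E (x)_R Omega^n, as the subspace of N (x) Omega spanned by its products *)
Definition tensor_forms (n : nat) (E : set (T -> OmegaK)) : set (T -> OmegaK) :=
  [set nu | exists (q : nat) (w : 'I_q -> Omega) (c : 'I_q -> T -> OmegaK),
    [/\ forall i, is_form n (w i), forall i, E (c i) &
        nu = fun t => \sum_i of_Omega (w i) * c i t]].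

Definition span_Phi0 (f : 'I_r -> R) : T -> OmegaK := fun t =>
  \sum_i of_R (f i) * Phi0 i t.

(* C_Pi = R Phi0(H) (+) E with E an acyclic subcomplex, E = E' (+) F and m / hbar
   an isomorphism from F to E'. *)
Record decomposition (E E' F : set (T -> OmegaK)) : Prop := Decomposition {
  dec_E : submodR E;
  dec_sum : forall nu, C_Pi nu <-> exists (f : 'I_r -> R) (e : T -> OmegaK),
    E e /\ nu = fun t => span_Phi0 f t + e t;
  dec_direct : forall f : 'I_r -> R, E (span_Phi0 f) -> span_Phi0 f = fun=> 0;
  dec_complex : forall e, E e -> E (m_h e);
  dec_acyclic : forall e, E e -> m_h e = (fun=> 0) -> exists2 e1, E e1 & e = m_h e1;
  dec_E' : submodR E';
  dec_F : submodR F;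
  dec_E'F : forall nu, E nu <->
    exists e f, [/\ E' e, F f & nu = fun t => e t + f t];
  dec_E'F_direct : forall e, E' e -> F e -> e = fun=> 0;
  dec_iso : set_bij F E' m_h }.

Record superconnection (E E' F : set (T -> OmegaK)) (A : nat -> 'M[Omega]_r)
    (Phi : nat -> 'I_r -> T -> OmegaK) : Prop := Superconnection {
  sc_dec : decomposition E E' F;
  sc_A : forall n i l, (0 < n)%N -> is_form n (A n i l);
  sc_Phi0 : forall i, Phi 0%N i = Phi0 i;
  sc_Phi : forall n i, (0 < n)%N -> tensor_forms n F (Phi n i);
  sc_eq : forall n i t,
    hK *: d_dR (Phi n i t) =
      \sum_(j < n.+1) \sum_l of_Omega (A (n.+1 - j)%N i l) * Phi j l t +
      m_h (Phi n.+1 i) t }.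

End Dirac.

(* The component of form degree n of nabla applied to the form-valued function on H
   taking x_i to the sum of the s n i. *)
Definition nabla (A : nat -> 'M[Omega]_r) (s : nat -> 'I_r -> OmegaK) (n : nat)
    (i : 'I_r) : OmegaK :=
  if n is q.+1 then
    hK *: d_dR (s q i) -
      \sum_(j < q.+1) \sum_l of_Omega (A (q.+1 - j)%N i l) * s j l
  else 0.

Record path_integral (J : bN B -> pser k) : Prop := PathIntegral {
  int_lin : forall c n p, J (c *: n + p) = c * J n + J p;
  int_act : forall x y n, J (bact (x * y) n) = J (bact x (bact y n));
  int_stokes : forall n, J (bact (bm B) n) = 0 }.

Definition integral (J : bN B -> pser k) (nu : T -> OmegaK) : OmegaK :=
  wsum (fun t => tofrac (J (gbas t)) *: nu t).

End Superconnection.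

(* Main.v *)
(* The integral of an element of N (x) Omega is a sum over a basis of N which
   converges hbar-adically, coefficient by coefficient.  It therefore commutes
   with d_dR and with multiplication by forms, and by the Stokes axiom it kills
   every m nu / hbar.  Integrating the equations that define A and Phi thus
   removes their last term and leaves the assertion. *)
Require Import Defs.
From HB Require Import structures.
From mathcomp Require Import all_boot all_order all_algebra.
From mathcomp Require Import fraction.
From mathcomp Require Import boolp classical_sets functions.
From mathcomp Require Import cardinality fsbigop.
Set Implicit Arguments.
Unset Strict Implicit.
Unset Printing Implicit Defensive.
Import GRing.Theory.
Local Open Scope ring_scope.

(** * The hbar-adic filtration of [k((hbar))] *)

Section Adic.
Variable k : fieldType.
Local Notation K := {fraction (pser k)}.
Implicit Types (x y : K) (c : pser k).

Lemma hbar_expE j n : ((hbar : pser k) ^+ j) n = (n == j)%:R.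
Proof.
elim: j n => [|j IH] n; first by rewrite expr0 /=; case: (n == 0%N).
rewrite exprS /=; case: n => [|n].
  by rewrite big_ord_recl big_ord0 mul0r addr0.
rewrite big_ord_recl mul0r add0r big_ord_recl /= mul1r subSS subn0 IH.
by rewrite big1 ?addr0 // => i _; rewrite mul0r.
Qed.

Lemma hbar_expM j c n :
  (hbar ^+ j * c) n = if (n < j)%N then 0 else c (n - j)%N.
Proof.
rewrite /=; have [nj|jn] := ltnP n j.
  rewrite big1 // => i _; rewrite hbar_expE.
  by rewrite (ltn_eqF (leq_ltn_trans (leq_ord i) nj)) mul0r.
rewrite (bigD1 (inord j)) //= hbar_expE inordK ?ltnS // eqxx mul1r.
rewrite big1 ?addr0 // => i ij; rewrite hbar_expE.
case: eqP => [ej|]; last by rewrite mul0r.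
by case/eqP: ij; apply: val_inj; rewrite /= inordK ?ltnS.
Qed.

Lemma hbar_neq0 : (hbar : pser k) != 0.
Proof. by apply/eqP => /pserP/(_ 1%N)/eqP; rewrite /= oner_eq0. Qed.

Lemma tofrac_sum (I : Type) (s : seq I) (c : I -> pser k) :
  tofrac (\sum_(i <- s) c i) = \sum_(i <- s) tofrac (c i) :> K.
Proof. exact: (raddf_sum (@tofrac _)). Qed.

(** Membership in the filtration is stated with a quotient as witness. For elements of [k[[hbar]]]
    this becomes a condition on coefficients, the quotient being the series shifted by [j]. *)
Lemma hadic_tofrac j c :
  hadic j (tofrac c) <-> forall n, (n < j)%N -> c n = 0.
Proof.
split=> [[l /eqP]|c0].
  by rewrite tofrac_eq => /eqP -> n nj; rewrite hbar_expM nj.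
exists (Pser (fun n => c (n + j)%N)); congr tofrac; apply/pserP => n.
by rewrite hbar_expM; case: ltnP => [/c0 //|jn] /=; rewrite subnK.
Qed.

Lemma hadic0 j : hadic j (0 : K).
Proof. by exists 0; rewrite mulr0 tofrac0. Qed.

Lemma hadicD j x y : hadic j x -> hadic j y -> hadic j (x + y).
Proof. by move=> [l ->] [m ->]; exists (l + m); rewrite mulrDr tofracD. Qed.

Lemma hadicM j c x : hadic j x -> hadic j (tofrac c * x).
Proof. by move=> [l ->]; exists (c * l); rewrite -tofracM mulrCA. Qed.

Lemma hadicN j x : hadic j x -> hadic j (- x).
Proof. by move=> hx; rewrite -mulN1r -tofrac1 -tofracN; apply: hadicM. Qed.

Lemma hadicB j x y : hadic j x -> hadic j y -> hadic j (x - y).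
Proof. by move=> hx hy; apply/hadicD/hadicN. Qed.

Lemma hadic_sum j (I : eqType) (s : seq I) (f : I -> K) :
  (forall i, i \in s -> hadic j (f i)) -> hadic j (\sum_(i <- s) f i).
Proof.
move=> h; rewrite big_seq.
by apply: (big_ind (hadic j)); [apply: hadic0|apply: hadicD|].
Qed.

(** Dividing by [hbar] costs exactly one step of the filtration. This controls the factor [hbar^-1]
    in [m_h]. *)
Lemma hadic_hKV j x : hadic j.+1 x -> hadic j ((hK k)^-1 * x).
Proof.
move=> [l ->]; exists l; rewrite exprS -mulrA tofracM mulrA mulVf ?mul1r //.
by rewrite tofrac_eq0 hbar_neq0.
Qed.

(** The filtration is separated: level 0 puts [x] in [k[[hbar]]], and level [n.+1] then kills its
    coefficient [n]. Uniqueness of sums rests on this. *)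
Lemma hadic_eq0 x : (forall j, hadic j x) -> x = 0.
Proof.
move=> hx; have [l xl] := hx 0%N; rewrite mul1r in xl.
rewrite xl in hx *; rewrite (_ : l = 0) ?tofrac0 //.
apply/pserP => n; rewrite /= if_same.
by have /hadic_tofrac -> := hx n.+1.
Qed.

End Adic.

(** * Convergence of hbar-adic sums *)

Section Hsum.
Variables (k : fieldType) (J : choiceType).
Local Notation K := {fraction (pser k)}.
Implicit Types (f g : J -> K) (x y : K) (c : pser k) (s u : seq J).

Lemma big_uniq_sub (V : nmodType) (F : J -> V) s u :
  uniq s -> uniq u -> {subset s <= u} -> (forall i, i \notin s -> F i = 0) ->
  \sum_(i <- u) F i = \sum_(i <- s) F i.
Proof.
move=> us uu su F0; rewrite (bigID (mem s)) /= [X in _ + X]big1 // addr0.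
rewrite -big_filter; apply/perm_big/uniq_perm; rewrite ?filter_uniq //.
by move=> i; rewrite mem_filter; case: (boolP (i \in s)) => //= /su.
Qed.

(** Terms tending to 0 suffice for summability, because the topology is complete and nonarchimedean.
    [in_N] says that each coefficient of [nu] is such a family. *)
Definition null_family f := forall j,
  finite_set [set i | ~ hadic j (f i)]%classic.

Lemma null_familyP f j : null_family f ->
  exists2 s, uniq s & forall i, i \notin s -> hadic j (f i).
Proof.
move=> /(_ j)/finite_seqP[s sE]; exists (undup s); first exact: undup_uniq.
move=> i; rewrite mem_undup => is_; apply: contrapT => h.
by case/negP: is_; suff : [set` s]%classic i by []; rewrite -sE.
Qed.

Lemma null_familyI f :
  (forall j, exists s, forall i, i \notin s -> hadic j (f i)) -> null_family f.
Proof.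
move=> h j; have [s sP] := h j; apply: sub_finite_set (finite_seq s) => i /= hi.
by apply: contrapT => /negP/sP.
Qed.

Lemma is_hsum_uniq f x y : is_hsum f x -> is_hsum f y -> x = y.
Proof.
move=> fx fy; apply/eqP; rewrite -subr_eq0; apply/eqP/hadic_eq0 => j.
have [s sP] := fx j; have [s' sP'] := fy j; pose u := undup (s ++ s').
have -> : x - y = (x - \sum_(i <- u) f i) - (y - \sum_(i <- u) f i).
  by rewrite opprB addrA addrNK.
by apply: hadicB; [apply: sP => [|i h]|apply: sP' => [|i h]];
  rewrite ?undup_uniq // mem_undup mem_cat h ?orbT.
Qed.

Lemma is_hsumD f g x y : is_hsum f x -> is_hsum g y ->
  is_hsum (fun i => f i + g i) (x + y).
Proof.
move=> fx gy j; have [s sP] := fx j; have [s' sP'] := gy j.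
exists (s ++ s') => u uu su; rewrite big_split opprD addrACA.
by apply: hadicD; [apply: sP => // i h|apply: sP' => // i h]; apply: su;
  rewrite mem_cat h ?orbT.
Qed.

Lemma is_hsumM c f x :
  is_hsum f x -> is_hsum (fun i => tofrac c * f i) (tofrac c * x).
Proof.
move=> fx j; have [s sP] := fx j; exists s => u uu su.
by rewrite -mulr_sumr -mulrBr; apply/hadicM/sP.
Qed.

Lemma is_hsum_finite f s :
  uniq s -> (forall i, i \notin s -> f i = 0) -> is_hsum f (\sum_(i <- s) f i).
Proof.
move=> us f0 j; exists s => u uu su; rewrite (big_uniq_sub us uu su f0) subrr.
exact: hadic0.
Qed.

Lemma is_hsum0 : is_hsum (fun _ : J => 0 : K) 0.
Proof. by have := @is_hsum_finite (fun=> 0) [::] isT; rewrite big_nil; apply. Qed.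

Lemma is_hsum_sum (I : Type) (r : seq I) (F : I -> J -> K) (X : I -> K) :
  (forall i, is_hsum (F i) (X i)) ->
  is_hsum (fun t => \sum_(i <- r) F i t) (\sum_(i <- r) X i).
Proof.
move=> h; elim: r => [|i r IH].
  by rewrite big_nil (_ : (fun _ => _) = fun=> 0);
    [exact: is_hsum0|apply/funext => t; rewrite big_nil].
rewrite big_cons (_ : (fun _ => _) = fun t => F i t + \sum_(i <- r) F i t).
  exact: is_hsumD.
by apply/funext => t; rewrite big_cons.
Qed.

(** Convergence only yields some unspecified good list. Since small terms add up to something small,
    any list containing all the large terms is as good, as a comparison over the union of both lists
    shows. *)
Lemma is_hsum_approx f x j s : is_hsum f x -> uniq s ->
  (forall i, i \notin s -> hadic j (f i)) -> hadic j (x - \sum_(i <- s) f i).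
Proof.
move=> fx us fs; have [s' sP] := fx j; pose u := undup (s' ++ s).
have uu : uniq u by apply: undup_uniq.
rewrite -[x](subrK (\sum_(i <- u) f i)) -addrA; apply: hadicD.
  by apply: sP => // i h; rewrite mem_undup mem_cat h.
have -> : \sum_(i <- s) f i = \sum_(i <- u) if i \in s then f i else 0.
  rewrite (big_uniq_sub us uu) => [||i /negPf -> //].
    by apply: eq_big_seq => i ->.
  by move=> i h; rewrite mem_undup mem_cat h orbT.
rewrite -sumrB; apply: hadic_sum => i _; case: ifPn => [_|/fs].
  by rewrite subrr; apply: hadic0.
by rewrite subr0.
Qed.

(** This is completeness of [k[[hbar]]]: only finitely many terms contribute to each coefficient, so
    the limit is built coefficient by coefficient. *)
Lemma is_hsum_integral (l : J -> pser k) : null_family (fun i => tofrac (l i)) ->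
  exists x, is_hsum (fun i => tofrac (l i)) x.
Proof.
move=> nl; have /choice[s sP] : forall j, exists s, uniq s /\
    forall i, i \notin s -> hadic j (tofrac (l i)).
  by move=> j; have [s us h] := null_familyP j nl; exists s.
(* Terms outside [s n.+1] are divisible by [hbar ^+ n.+1], hence have coefficient [n] equal to 0.
   Joining these lists for [n < j] gives agreement modulo [hbar ^+ j]. *)
exists (tofrac (Pser (fun n => \sum_(i <- s n.+1) l i n))) => j.
exists (flatten [seq s n.+1 | n <- iota 0 j]) => u uu su.
rewrite -tofrac_sum -tofracB; apply/hadic_tofrac => n nj.
have coefB (a b : pser k) m : (a - b) m = a m - b m by [].
have coefS m : (\sum_(i <- u) l i) m = \sum_(i <- u) l i m.
  elim: (u) => [|i v IH]; first by rewrite !big_nil /= if_same.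
  by rewrite !big_cons -IH.
rewrite coefB coefS /=; have [us fs] := sP n.+1.
rewrite (big_uniq_sub us uu) ?subrr // => i; last first.
  by move=> /fs/hadic_tofrac; apply.
move=> h; apply: su; apply/flattenP; exists (s n.+1) => //.
by apply/mapP; exists n; rewrite // mem_iota.
Qed.

(** Only finitely many terms of a null family lie outside [k[[hbar]]]. They are summed separately,
    and completeness of [k[[hbar]]] handles the rest. *)
Lemma is_hsum_ex f : null_family f -> exists x, is_hsum f x.
Proof.
move=> nf; have [s us sP] := null_familyP 0 nf.
have /choice[l lP] : forall i, exists c, i \notin s -> f i = tofrac c.
  move=> i; case: (boolP (i \in s)) => [|/sP[c fc]]; first by exists 0.
  by exists c; rewrite mul1r in fc.
pose l' i := if i \in s then 0 else l i.
have fE : f = fun i => (if i \in s then f i else 0) + tofrac (l' i).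
  apply/funext => i; rewrite /l'; case: ifPn => [_|/lP ->].
    by rewrite tofrac0 addr0.
  by rewrite add0r.
have [|x hx] := @is_hsum_integral l'.
  apply: null_familyI => j; have [s' _ sP'] := null_familyP j nf.
  exists s' => i /sP'; rewrite /l'; case: ifPn => [_ _|/lP -> //].
  by rewrite tofrac0; apply: hadic0.
exists (\sum_(i <- s) (if i \in s then f i else 0) + x).
rewrite [X in is_hsum X]fE; apply: is_hsumD hx.
by apply: is_hsum_finite => // i /negPf ->.
Qed.

Lemma hsumP f : null_family f -> is_hsum f (hsum f).
Proof. by move=> /is_hsum_ex[x]; apply: xgetI. Qed.

Lemma eq_null_family f g : f =1 g -> null_family g -> null_family f.
Proof. by move=> /funext ->. Qed.

Lemma eq_is_hsum f g x : f =1 g -> is_hsum g x -> is_hsum f x.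
Proof. by move=> /funext ->. Qed.

Lemma null_familyM (c : J -> pser k) f :
  null_family f -> null_family (fun i => tofrac (c i) * f i).
Proof.
move=> nf; apply: null_familyI => j; have [s _ sP] := null_familyP j nf.
by exists s => i /sP; apply: hadicM.
Qed.

Lemma null_family_sum (I : Type) (r : seq I) (F : I -> J -> K) :
  (forall i, null_family (F i)) -> null_family (fun t => \sum_(i <- r) F i t).
Proof.
move=> h; apply: null_familyI => j; elim: r => [|i r [s sP]].
  by exists [::] => t _; rewrite big_nil; apply: hadic0.
have [s' _ sP'] := null_familyP j (h i); exists (s ++ s') => t.
by rewrite mem_cat negb_or big_cons => /andP[/sP ? /sP' ?]; apply: hadicD.
Qed.

End Hsum.

(** * Linear maps and finite expansions in a basis *)

Section Linear.
Variable k : fieldType.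

Lemma lin_sum (M N : lmodType (pser k)) (f : M -> N)
    (fl : forall c x y, f (c *: x + y) = c *: f x + f y)
    (I : Type) (s : seq I) (c : I -> pser k) (v : I -> M) :
  f (\sum_(i <- s) c i *: v i) = \sum_(i <- s) c i *: f (v i).
Proof.
elim: s => [|i s IH]; last by rewrite !big_cons fl IH.
(* The hypothesis at [c = 1], [x = y = 0] reads [f 0 = f 0 + f 0], so [f 0 = 0]. *)
rewrite !big_nil; have := fl 1 0 0; rewrite !scale1r addr0 => /eqP.
by rewrite -[X in X == _]addr0 (inj_eq (addrI _)) eq_sym => /eqP.
Qed.

Lemma form_sum (M : lmodType (pser k)) (f : M -> pser k)
    (fl : forall c x y, f (c *: x + y) = c * f x + f y)
    (I : Type) (s : seq I) (c : I -> pser k) (v : I -> M) :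
  f (\sum_(i <- s) c i *: v i) = \sum_(i <- s) c i * f (v i).
Proof. exact: (@lin_sum M (pser k)^o f fl). Qed.

Lemma gco_sum_seq (M : lmodType (pser k)) (F : gfree M) (x : M)
    (s : seq (gidx F)) :
  uniq s -> (forall i, i \notin s -> gco x i = 0) ->
  x = \sum_(i <- s) gco x i *: gbas i.
Proof.
move=> us xs; rewrite [LHS](gco_sum F) (fsbigE s) // => [|i _ /xs ->].
  by apply: eq_bigl => i; rewrite in_setT.
by rewrite scale0r.
Qed.

Lemma gco_supp (M : lmodType (pser k)) (F : gfree M) (x : M) :
  exists2 s : seq (gidx F), uniq s & forall i, i \notin s -> gco x i = 0.
Proof.
have /finite_seqP[s sE] := gco_fin F x; exists (undup s); first exact: undup_uniq.
move=> i; rewrite mem_undup => is_; apply/eqP/negPn/negP => h.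
by case/negP: is_; suff : [set` s]%classic i by []; rewrite -sE.
Qed.

End Linear.

(** * Coefficients of forms and operators acting on them *)

Section Forms.
Variables (k : fieldType) (B : background k) (r : nat) (d : 'I_r -> int).
Local Notation K := {fraction (pser k)}.
Local Notation S := (gidx (bPf B)).
Local Notation T := (gidx (bNf B)).
Local Notation W := (OmegaK k d).

Lemma coefD (v w : W) a : (v + w) a = v a + w a.
Proof. exact: gaddE. Qed.

Lemma coefZ (c : K) (w : W) a : (c *: w) a = c * w a.
Proof. exact: gscaleE. Qed.

Lemma coef0 (C : comNzRingType) (I : finType) (deg : I -> int) a :
  (0 : gps C deg) a = 0.
Proof. by have := gconstE deg (0 : C) a; rewrite if_same. Qed.

Lemma coef_sum (I : Type) (s : seq I) (F : I -> W) a :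
  (\sum_(i <- s) F i) a = \sum_(i <- s) F i a.
Proof.
by apply: (big_morph (fun w : W => w a)) => [v w|];
  [exact: coefD|exact: coef0].
Qed.

Lemma coefM (v w : W) a : (v * w) a = if admissible (vdeg d) a then
  \sum_(b <- below a)
    (-1) ^+ koszul (vdeg d) b (esub a b) * (v b * w (esub a b)) else 0.
Proof. by []. Qed.

Lemma coef_wsum (I : choiceType) (f : I -> W) a :
  wsum f a = if admissible (vdeg d) a then hsum (fun i => f i a) else 0.
Proof. by []. Qed.

Lemma coef_gsign (w : W) a :
  gsign w a = (-1) ^+ oddz (edeg (vdeg d) a) * w a.
Proof. by rewrite /=; case: ifPn => // na; rewrite gps_out // mulr0. Qed.

(* Every coefficient of L w is a finite k[[hbar]]-combination of coefficients of
   w, so that L commutes with hbar-adically convergent sums. *)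
Definition coef_local (L : W -> W) := forall a,
  exists s : seq (pser k * {ffun 'I_r + 'I_r -> nat}),
    forall w, L w a = \sum_(p <- s) tofrac p.1 * w p.2.

Lemma coef_localZ c L :
  coef_local L -> coef_local (fun w => tofrac c *: L w).
Proof.
move=> Ll a; have [s sE] := Ll a; exists [seq (c * p.1, p.2) | p <- s] => w.
rewrite coefZ sE big_map mulr_sumr; apply: eq_bigr => p _.
by rewrite tofracM mulrA.
Qed.

Lemma coef_local_comp L M :
  coef_local L -> coef_local M -> coef_local (fun w => L (M w)).
Proof.
move=> Ll Ml a; have [s sE] := Ll a; have /choice[t tE] := Ml.
exists [seq (p.1 * q.1, q.2) | p <- s, q <- t p.2] => w.
rewrite sE big_allpairs_dep; apply: eq_bigr => p _.
by rewrite tE mulr_sumr; apply: eq_bigr => q _; rewrite tofracM mulrA.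
Qed.

Lemma coef_local_sum (I : Type) (u : seq I) (L : I -> W -> W) :
  (forall i, coef_local (L i)) -> coef_local (fun w => \sum_(i <- u) L i w).
Proof.
move=> Ll a; have /choice[s sE] := fun i => Ll i a.
exists [seq p | i <- u, p <- s i] => w.
by rewrite coef_sum big_allpairs_dep; apply: eq_bigr => i _; rewrite sE.
Qed.

(** Only the finitely many divisors of a monomial enter its coefficient in a product. The multiplier
    is taken in [Omega] so that the scalars, with the Koszul signs absorbed, stay in [k[[hbar]]]. *)
Lemma coef_local_mul (v : Omega k d) : coef_local (fun w => of_Omega v * w).
Proof.
move=> a; exists (if admissible (vdeg d) a then
  [seq ((-1) ^+ koszul (vdeg d) b (esub a b) * v b, esub a b) | b <- below a]
  else [::]) => w.
rewrite coefM; case: ifP => aa; last by rewrite big_nil.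
rewrite [RHS]big_map; apply: eq_big_seq => b; rewrite in_below => ba.
rewrite tofracM tofracXn tofracN tofrac1 -mulrA /= ifT //.
exact: ele_adm ba aa.
Qed.

Lemma of_R0 : of_R (0 : gps (pser k) (tdeg d)) = 0.
Proof.
apply/gpsP => a; rewrite coef0 /of_R /=; case: ifP => // _; case: ifP => // _.
by rewrite -[LHS]/(tofrac ((0 : gps (pser k) (tdeg d)) _)) coef0 tofrac0.
Qed.

Lemma of_R1 : of_R (1 : gps (pser k) (tdeg d)) = 1.
Proof.
apply/gpsP => a; have -> : (1 : W) a = if a == e0 _ then 1 else 0.
  exact: gconstE.
have -> : of_R (1 : gps (pser k) (tdeg d)) a = if admissible (vdeg d) a then
    if fdeg a == 0%N
    then tofrac (gconst (tdeg d) (1 : pser k) [ffun i => a (inl i)])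
    else 0 else 0 by [].
rewrite gconstE; have [->|a0] := eqVneq a (e0 _).
  rewrite adm0 /fdeg big1 => [|i _]; last by rewrite ffunE.
  rewrite eqxx ifT ?tofrac1 //.
  by apply/eqP/ffunP => i; rewrite !ffunE.
(* In form degree 0 every exponent of a [dt_i] vanishes, so a trivial exponent in the [t_i] would
   force [a] to be [e0]. *)
case: ifP => // _; case: eqP => // /eqP; rewrite sum_nat_eq0 => /forallP fa.
rewrite ifF ?tofrac0 //; apply: contraNF a0 => /eqP/ffunP ta.
apply/eqP/ffunP => -[i|i]; rewrite ffunE; last by have := fa i => /eqP.
by have := ta i; rewrite !ffunE.
Qed.

(** The factors [dt_i] in [d_dR] thereby fall under [coef_local_mul]. *)
Lemma gvar_of_Omega v : gvar K (vdeg d) v = of_Omega (gvar (pser k) (vdeg d) v).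
Proof.
apply/gpsP => a /=; case: ifP => // _.
by case: eqP; rewrite ?tofrac1 ?tofrac0.
Qed.

Lemma coef_local_gder v : coef_local (gder v).
Proof.
move=> a; exists (if admissible (vdeg d) a then
  [:: ((-1) ^+ koszul (vdeg d) (e1 v) a * (a v).+1%:R, eadd a (e1 v))]
  else [::]) => w.
rewrite /=; case: ifP => _; last by rewrite big_nil.
by rewrite big_seq1 tofracM tofracXn tofracN tofrac1 tofracMn -mulrA.
Qed.

Lemma coef_local_d_dR : coef_local (@d_dR k r d).
Proof.
apply: coef_local_sum => i; rewrite gvar_of_Omega.
exact: coef_local_comp (coef_local_mul _) (coef_local_gder _).
Qed.

Lemma in_N_local L (nu : T -> W) :
  coef_local L -> in_N nu -> in_N (fun t => L (nu t)).
Proof.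
move=> Ll nuN a; have [s sE] := Ll a.
apply: (eq_null_family (fun t => sE (nu t))).
by apply: null_family_sum => p; apply: (null_familyM (fun=> p.1)) (nuN p.2).
Qed.

Lemma in_N_sum (I : Type) (s : seq I) (F : I -> T -> W) :
  (forall i, in_N (F i)) -> in_N (fun t => \sum_(i <- s) F i t).
Proof.
move=> FN a; apply: (eq_null_family (fun t => coef_sum s (F^~ t) a)).
by apply: null_family_sum => i; apply: FN.
Qed.

(** * Integration of form-valued families *)

Section Pairing.
Variable J : bN B -> pser k.

(** Integration as a relation: its linearity can be proved without the chosen value inside [hsum],
    and [integrates_uniq] turns it back into equations. *)
Definition integrates (nu : T -> W) (w : W) := forall a,
  is_hsum (fun t => tofrac (J (gbas t)) * nu t a) (w a).

Lemma integrates_uniq nu v w : integrates nu v -> integrates nu w -> v = w.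
Proof. by move=> hv hw; apply/gpsP => a; apply: is_hsum_uniq (hv a) (hw a). Qed.

Lemma integralP nu : in_N nu -> integrates nu (integral J nu).
Proof.
move=> nuN a; have nf : null_family (fun t => tofrac (J (gbas t)) * nu t a).
  exact: null_familyM (nuN a).
rewrite coef_wsum; case: ifPn => aa.
  by under [X in hsum X]eq_fun do rewrite coefZ; apply: hsumP.
(* At an inadmissible exponent both the truncated coefficient of [wsum] and every term are 0. *)
apply: eq_is_hsum (@is_hsum0 _ _) => t.
by rewrite gps_out // mulr0.
Qed.

Lemma integratesD nu mu v w : integrates nu v -> integrates mu w ->
  integrates (fun t => nu t + mu t) (v + w).
Proof.
move=> hv hw a; rewrite coefD.
by apply: eq_is_hsum (is_hsumD (hv a) (hw a)) => t; rewrite coefD mulrDr.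
Qed.

Lemma integrates_sum (I : Type) (s : seq I) (F : I -> T -> W) (v : I -> W) :
  (forall i, integrates (F i) (v i)) ->
  integrates (fun t => \sum_(i <- s) F i t) (\sum_(i <- s) v i).
Proof.
move=> h a; rewrite coef_sum; have := is_hsum_sum s (fun i => h i a).
by apply: eq_is_hsum => t; rewrite coef_sum mulr_sumr.
Qed.

(** Convergent sums commute with finite [k[[hbar]]]-combinations, and each coefficient of [L] is
    one. This covers both [hbar d_dR] and multiplication by the entries of [A]. *)
Lemma integrates_local L nu w : coef_local L -> integrates nu w ->
  integrates (fun t => L (nu t)) (L w).
Proof.
move=> Ll hw a; have [s sE] := Ll a; rewrite sE.
have := is_hsum_sum s (fun p => is_hsumM p.1 (hw p.2)).
apply: eq_is_hsum => t; rewrite sE mulr_sumr.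
by apply: eq_bigr => p _; rewrite mulrCA.
Qed.

End Pairing.

(* m is odd, so it moves past the coefficients of nu through gsign. *)
Lemma Pact_cst_approx (nu : T -> W) t a j (u : seq T) : in_N nu -> uniq u ->
  (forall t', t' \notin u -> hadic j (nu t' a)) ->
  hadic j (Pact (ext_cst d (F := bPf B) (bm B)) nu t a -
    \sum_(t' <- u) tofrac (gco (bact (bm B) (gbas t')) t) * gsign (nu t') a).
Proof.
move=> nuN uu uP; have [aa|na] := boolP (admissible (vdeg d) a); last first.
  rewrite gps_out // big1 ?subrr; first exact: hadic0.
  by move=> t' _; rewrite gps_out // mulr0.
rewrite /Pact /ext_bilin coef_wsum aa; have [s us sP] := gco_supp (bPf B) (bm B).
pose sg : K := (-1) ^+ oddz (edeg (vdeg d) a).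
pose g (p : S * T) := tofrac (gco (bact (gbas p.1) (gbas p.2)) t) *
  (tofrac (gco (bm B) p.1) * (sg * nu p.2 a)).
rewrite (_ : (fun p => _) = g); last first.
  apply/funext => -[p1 p2]; rewrite coefZ /g; cbn [fst snd]; congr (_ * _).
  rewrite /ext_cst mulr_algl coefZ.
  (* The basis vectors occurring in [m] have degree 1, which fixes the sign as [sg]. For the others
     the parity is unknown but the term vanishes. *)
  have [->|m0] := eqVneq (gco (bm B) p1) 0; first by rewrite tofrac0 !mul0r.
  by rewrite (bm_deg m0) coef_gsign.
have sgE : sg = tofrac ((-1) ^+ oddz (edeg (vdeg d) a)).
  by rewrite tofracXn tofracN tofrac1.
(* Off the product of the two lists, either the coordinate of [m] is 0 or the coefficient of [nu] is
   small. This gives both the convergence of [g] and its approximation over [u]. *)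
have gP j' u' : (forall t', t' \notin u' -> hadic j' (nu t' a)) ->
    forall p, p \notin [seq (p1, p2) | p1 <- s, p2 <- u'] -> hadic j' (g p).
  move=> u'P [p1 p2] pn; rewrite /g /=; apply: hadicM.
  have [s1|/sP ->] := boolP (p1 \in s); last first.
    by rewrite tofrac0 mul0r; apply: hadic0.
  rewrite sgE; do 2!apply: hadicM; apply: u'P.
  by apply: contra pn => u2; apply/allpairsP; exists (p1, p2).
have gs : is_hsum g (hsum g).
  apply/hsumP/null_familyI => j'; have [u' _ u'P] := null_familyP j' (nuN a).
  by exists [seq (p1, p2) | p1 <- s, p2 <- u']; apply: gP.
have up : uniq [seq (p1, p2) | p1 <- s, p2 <- u].
  by apply: allpairs_uniq => // -[? ?] [? ?] _ _ [-> ->].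
have := is_hsum_approx gs up (gP j u uP).
rewrite big_allpairs exchange_big; congr (hadic _ (_ - _)).
apply: eq_bigr => t' _; rewrite coef_gsign /g; cbn [fst snd]; rewrite -/sg.
(* Summing over the support [s] of [m] reassembles the action of [m] on the basis vector [t']. *)
rewrite [bm B in RHS](gco_sum_seq us sP).
rewrite (lin_sum (f := fun x => bact x (gbas t'))); last first.
  by move=> *; apply: bact_linl.
rewrite (form_sum (f := fun n => gco n t)); last first.
  by move=> *; apply: gco_lin.
rewrite tofrac_sum mulr_suml; apply: eq_bigr => p _.
by rewrite tofracM mulrCA mulrA.
Qed.

(** To any given precision, finitely many basis vectors [t'] of [N] determine the coefficient of
    [m nu] at [a], with one list [u] serving all [t]. The sums over [t] and [t'] may then be
    exchanged, and the Stokes axiom applies to each [t'] separately. *)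
Lemma integrates_m_h (J : bN B -> pser k) (nu : T -> W) :
  path_integral J -> in_N nu -> integrates J (m_h nu) 0.
Proof.
move=> intJ nuN a j; rewrite coef0.
(* One extra power of [hbar] is kept in reserve for the division in [m_h]. *)
have [u uu uP] := null_familyP j.+1 (nuN a).
have /choice[v vP] (t' : T) : exists v : seq T, uniq v /\
    forall t, t \notin v -> gco (bact (bm B) (gbas t')) t = 0.
  by have [v] := gco_supp (bNf B) (bact (bm B) (gbas t')); exists v.
(* Any list containing these supports sees all of [m] applied to [gbas t'], for each [t'] in [u]. *)
exists (flatten [seq v t' | t' <- u]) => s us vs.
rewrite sub0r; apply: hadicN.
pose G (t : T) := \sum_(t' <- u)
  tofrac (gco (bact (bm B) (gbas t')) t) * gsign (nu t') a.
(* After the exchange, the inner sum over [t] is the pairing of [J] with [m] applied to [gbas t'],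
   an exact zero. *)
have G0 : \sum_(t <- s) tofrac (J (gbas t)) * G t = 0.
  rewrite /G; under eq_bigr do rewrite mulr_sumr.
  rewrite exchange_big big_seq big1 //= => t' ut'.
  under eq_bigr do rewrite mulrA -tofracM.
  rewrite -mulr_suml -tofrac_sum.
  under eq_bigr do rewrite mulrC.
  have -> : \sum_(t <- s) gco (bact (bm B) (gbas t')) t * J (gbas t) =
      J (bact (bm B) (gbas t')).
    rewrite [bact _ _ in RHS](gco_sum_seq (F := bNf B) us) => [|t ts].
      by rewrite (form_sum (int_lin intJ)).
    have [_ -> //] := vP t'; apply: contra ts => tv; apply: vs.
    by apply/flattenP; exists (v t') => //; apply: map_f.
  by rewrite (int_stokes intJ) tofrac0 mul0r.
suff : hadic j (\sum_(t <- s) tofrac (J (gbas t)) * m_h nu t a -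
    (hK k)^-1 * \sum_(t <- s) tofrac (J (gbas t)) * G t).
  by rewrite G0 mulr0 subr0.
rewrite mulr_sumr -sumrB; apply: hadic_sum => t _.
rewrite coefZ mulrCA -mulrBr; apply: hadic_hKV; rewrite -mulrBr.
exact/hadicM/Pact_cst_approx.
Qed.

(** Everything is traced back to [C_Pi], whose elements satisfy [in_N] by definition. For [n > 0],
    [Phi n i] is a finite combination, with forms as coefficients, of elements of [F], hence of [E],
    hence of [C_Pi]. *)
Lemma Phi_in_N (Pi : S -> Rdg k d) E E' F A (Phi : nat -> 'I_r -> T -> W) n i :
  superconnection Pi E E' F A Phi -> in_N (Phi n i).
Proof.
move=> sc; have dec := sc_dec sc.
have CN nu : C_Pi Pi nu -> in_N nu by case.
have EN e : E e -> in_N e.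
  move=> Ee; apply/CN/(dec_sum dec); exists (fun=> 0), e; split=> //.
  apply/funext => t; rewrite /span_Phi0 big1 ?add0r // => l _.
  by rewrite of_R0 mul0r.
case: n => [|n].
  rewrite (sc_Phi0 sc); apply/CN/(dec_sum dec).
  (* [Phi0 i] is the combination with Kronecker delta coefficients and zero component in [E]. *)
  exists (fun l => (l == i)%:R), (fun=> 0); split; first by case: (dec_E dec).
  apply/funext => t; rewrite /span_Phi0 addr0 (bigD1 i) //= eqxx.
  rewrite big1 => [|l /negPf ->].
    by rewrite addr0 of_R1 mul1r.
  by rewrite of_R0 mul0r.
have [q [w [c [_ cF ->]]]] := sc_Phi sc i (ltn0Sn n).
apply: in_N_sum => l; apply: in_N_local (coef_local_mul _) _; apply: EN.
(* An element of [F] lies in [E] with zero component in [E']. *)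
apply/(dec_E'F dec); exists (fun=> 0), (c l).
split; [by case: (dec_E' dec)|exact: cF|].
by apply/funext => t; rewrite add0r.
Qed.

End Forms.

(** * Flatness of the primary correlation form *)

Theorem theorem5p1 (k : fieldType) (char0 : [pchar k] =i pred0)
    (B : background k) (r : nat) (d : 'I_r -> int)
    (x : 'I_r -> gidx (bPf B) -> dualn k) (Pi : gidx (bPf B) -> Rdg k d)
    (smooth : smooth_formal x Pi)
    (E E' F : set (gidx (bNf B) -> OmegaK k d))
    (A : nat -> 'M[Omega k d]_r)
    (Phi : nat -> 'I_r -> gidx (bNf B) -> OmegaK k d)
    (super : superconnection Pi E E' F A Phi)
    (J : bN B -> pser k) (intJ : path_integral J) :
  (forall n i, nabla A (fun q l => integral J (Phi q l)) n i = 0) /\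
  (forall n i,
    hK k *: d_dR (integral J (Phi n i)) =
      \sum_(j < n.+1) \sum_l of_Omega (A (n.+1 - j)%N i l) * integral J (Phi j l)).
Proof.
have PhiN n i : in_N (Phi n i) by apply: Phi_in_N super.
suff flat n i : hK k *: d_dR (integral J (Phi n i)) =
    \sum_(j < n.+1) \sum_l of_Omega (A (n.+1 - j)%N i l) * integral J (Phi j l).
  (* The component of [nabla] in form degree [n.+1] is the difference of the two sides at [n]; in
     form degree 0 it is 0 by definition. *)
  by split=> // -[|n] i //=; rewrite flat subrr.
(* Both sides are shown to integrate the single family [hbar d_dR (Phi n i)]: the left by moving
   [d_dR] through the sum, the right by first rewriting the family with [sc_eq]. *)
apply: (@integrates_uniq _ B _ _ J (fun t => hK k *: d_dR (Phi n i t))).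
  apply: (integrates_local (L := fun w => hK k *: d_dR w)).
    exact/coef_localZ/coef_local_d_dR.
  exact: integralP.
rewrite (_ : (fun t => _) = fun t =>
    \sum_(j < n.+1) \sum_l of_Omega (A (n.+1 - j)%N i l) * Phi j l t +
    m_h (Phi n.+1 i) t); last by apply/funext => t; apply: sc_eq super _ _ _.
(* The added 0 is the integral of the last term, [m_h (Phi n.+1 i)]. *)
rewrite -[X in integrates _ _ X]addr0.
apply: integratesD (integrates_m_h intJ (PhiN _ _)).
apply: integrates_sum => j; apply: integrates_sum => l.
exact: integrates_local (coef_local_mul _) (integralP J (PhiN _ _)).
Qed.
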